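(* Let $n\ge2$ and $G=\frac1n(1,1)$ acting on $\Bbbk_J[u,v]$. Then $\Bbbk_J[u,v]^G\cong\Bbbk\langle X_0,\dots,X_n\rangle/I$, via $X_i\mapsto\frac{(-1)^i}{i!}u^{n-i}v^i$, where $I$ is the two-sided ideal generated by $$\sum_{k=0}^{j}\binom{n-i}{k}X_{j-k}X_i-\sum_{\ell=0}^{i}\binom{n-j}{\ell}X_{i-\ell}X_j\qquad(0\le i<j\le n),$$ $$iX_iX_j-(j+1)X_{i-1}X_{j+1}+\big(n-1-(j-i)\big)X_{i-1}X_j\qquad(1\le i\le j<n).$$
   Context: $\Bbbk$ is algebraically closed of characteristic $0$; $\Bbbk_J[u,v]=\Bbbk\langle u,v\rangle/(vu-uv-u^2)$, graded with $\deg u=\deg v=1$. $\frac1n(1,1)$ is the cyclic group generated by $\mathrm{diag}(\omega_n,\omega_n)$, $\omega_n$ a primitive $n$th root of unity, acting by $u\mapsto\omega_nu$, $v\mapsto\omega_nv$; its invariant ring is the $n$th Veronese subring $\bigoplus_{i\ge0}\Bbbk_J[u,v]_{ni}$. *)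

(* Defs.v *)
From HB Require Import structures.
From mathcomp Require Import all_boot all_order all_algebra.
Set Implicit Arguments. Unset Strict Implicit. Unset Printing Implicit Defensive.
Import GRing.Theory.
Local Open Scope ring_scope.

(* Noncommutative polynomials (elements of the free algebra K<V>) represented
   as formal linear combinations of words: a list of (coefficient, word).
   Two representatives denote the same element iff all their coefficients
   agree (nceq). *)
Definition ncpoly (K : Type) (V : Type) := seq (K * seq V).

Section NC.
Variables (K : fieldType) (V W : eqType).

Definition coefnc (p : ncpoly K V) (w : seq V) : K :=
  \sum_(t <- p | t.2 == w) t.1.
Definition nceq (p q : ncpoly K V) : Prop := forall w, coefnc p w = coefnc q w.
Definition ncadd (p q : ncpoly K V) : ncpoly K V := p ++ q.
Definition ncscale (c : K) (p : ncpoly K V) : ncpoly K V :=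
  [seq (c * t.1, t.2) | t <- p].
Definition ncsub (p q : ncpoly K V) : ncpoly K V := ncadd p (ncscale (-1) q).
Definition ncmul (p q : ncpoly K V) : ncpoly K V :=
  [seq (s.1 * t.1, s.2 ++ t.2) | s <- p, t <- q].
Definition ncconst (c : K) : ncpoly K V := [:: (c, [::])].
Definition ncvar (x : V) : ncpoly K V := [:: (1, [:: x])].
Definition ncword (w : seq V) : ncpoly K V := [:: (1, w)].

Definition in_ideal (S : ncpoly K V -> Prop) (p : ncpoly K V) : Prop :=
  exists l : seq (ncpoly K V * ncpoly K V * ncpoly K V),
    (forall t, t \in l -> S t.1.2) /\
    nceq p (flatten [seq ncmul (ncmul t.1.1 t.1.2) t.2 | t <- l]).

End NC.

Section Eval.
Variables (K : fieldType) (V W : eqType).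
Definition ncevalword (f : V -> ncpoly K W) (w : seq V) : ncpoly K W :=
  foldr (fun x (acc : ncpoly K W) => @ncmul K W (f x) acc) (@ncconst K W 1) w.
Definition nceval (f : V -> ncpoly K W) (p : ncpoly K V) : ncpoly K W :=
  flatten [seq @ncscale K W t.1 (ncevalword f t.2) | t <- p].
End Eval.

(* The Jordan plane K_J[u,v] = K<u,v>/(vu - uv - u^2); letters: u = false, v = true. *)
Definition lu : bool := false.
Definition lv : bool := true.

Section Jordan.
Variable K : fieldType.

Definition jrel : ncpoly K bool :=
  ncsub (ncsub (ncword K [:: lv; lu]) (ncword K [:: lu; lv])) (ncword K [:: lu; lu]).

Definition inJ (f : ncpoly K bool) : Prop := in_ideal (fun q => q = jrel) f.

(* the class of f in K_J[u,v] lies in the n-th Veronese subring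
   \bigoplus_i K_J[u,v]_{ni}, i.e. it is the class of an element whose
   homogeneous components all have degree divisible by n *)
Definition in_veronese (n : nat) (f : ncpoly K bool) : Prop :=
  exists g : ncpoly K bool,
    (forall w, ~~ (n %| size w)%N -> coefnc g w = 0) /\ inJ (ncsub f g).

Definition xgen (n : nat) (i : 'I_n.+1) : ncpoly K bool :=
  ncscale ((-1) ^+ i / (i`!)%:R) (ncword K (nseq (n - i) lu ++ nseq i lv)).

Definition X (n : nat) (i : nat) : ncpoly K 'I_n.+1 := ncvar K (inord i).

Definition rel1 (n i j : nat) : ncpoly K 'I_n.+1 :=
  ncsub (flatten [seq ncscale ('C(n - i, k))%:R (ncmul (X n (j - k)) (X n i))
                   | k <- iota 0 j.+1])
        (flatten [seq ncscale ('C(n - j, l))%:R (ncmul (X n (i - l)) (X n j))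
                   | l <- iota 0 i.+1]).

Definition rel2 (n i j : nat) : ncpoly K 'I_n.+1 :=
  ncadd (ncsub (ncscale i%:R (ncmul (X n i) (X n j)))
               (ncscale (j.+1)%:R (ncmul (X n i.-1) (X n j.+1))))
        (ncscale (n.-1 - (j - i))%:R (ncmul (X n i.-1) (X n j))).

Definition relI (n : nat) (p : ncpoly K 'I_n.+1) : Prop :=
  (exists i j : nat, (i < j)%N /\ (j <= n)%N /\ p = rel1 n i j) \/
  (exists i j : nat, (1 <= i)%N /\ (i <= j)%N /\ (j < n)%N /\ p = rel2 n i j).
End Jordan.

(* Main.v *)
Require Import Defs.
From HB Require Import structures.
From mathcomp Require Import all_boot all_order all_algebra.
From mathcomp Require Import ring zify.
Import GRing.Theory.
Local Open Scope ring_scope.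
Set Implicit Arguments.
Unset Strict Implicit.
Unset Printing Implicit Defensive.

(** The Jordan plane embeds in differential operators in one variable [t], by
    [u = - 1/t] and [v = d/dt].  With [theta = t d/dt] its component of degree
    [m] becomes the space of [t^-m q(theta)] with [deg q <= m], and multiplying
    by a factor of degree [N] on the right shifts [theta] by [N] in the left
    factor.  Here [X_i] becomes, up to a common sign,
    [t^-n binom(theta, i)], so that the first family of relations is
    Vandermonde's identity and the second one is the recurrence of binomial
    coefficients.  Conversely, the relations rewrite [X_a X_b] unless [a = 0] or
    [b = n], so words [X_0 .. X_0 X_i X_n .. X_n] span the quotient; in degree
    [m] their images have pairwise distinct degrees [0, .., n m] in [theta],
    hence form a basis of the degree [n m] part of the Jordan plane.  The
    presentation of the Jordan plane itself is treated in the same way, as the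
    case [n = 1]. *)

(** * Linear extension of maps on words to the free algebra *)

Section LinearExtension.
Variables (K : fieldType) (V : eqType).
Implicit Types (p q : ncpoly K V) (w : seq V).

(** Equality in the free algebra is tested through linear maps: [nceq_lin] makes [lin F] independent
    of the representative, and by [lin_nceq] the maps to [K^o] detect equality. *)
Definition lin (M : lmodType K) (F : seq V -> M) p : M :=
  \sum_(t <- p) t.1 *: F t.2.

Lemma lin_nil (M : lmodType K) (F : seq V -> M) : lin F [::] = 0.
Proof. by rewrite /lin big_nil. Qed.

Lemma lin_cons (M : lmodType K) (F : seq V -> M) t p :
  lin F (t :: p) = t.1 *: F t.2 + lin F p.
Proof. by rewrite /lin big_cons. Qed.

Lemma lin_cat (M : lmodType K) (F : seq V -> M) p q :
  lin F (p ++ q) = lin F p + lin F q.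
Proof. by rewrite /lin big_cat. Qed.

Lemma lin_add (M : lmodType K) (F : seq V -> M) p q :
  lin F (ncadd p q) = lin F p + lin F q.
Proof. exact: lin_cat. Qed.

Lemma lin_scale (M : lmodType K) (F : seq V -> M) c p :
  lin F (ncscale c p) = c *: lin F p.
Proof.
rewrite /lin big_map scaler_sumr.
by apply: eq_bigr => t _; rewrite scalerA.
Qed.

Lemma lin_sub (M : lmodType K) (F : seq V -> M) p q :
  lin F (ncsub p q) = lin F p - lin F q.
Proof. by rewrite lin_add lin_scale scaleN1r. Qed.

Lemma lin_word (M : lmodType K) (F : seq V -> M) w : lin F (ncword K w) = F w.
Proof. by rewrite lin_cons lin_nil addr0 scale1r. Qed.

Lemma lin_flatten (M : lmodType K) (F : seq V -> M) (ps : seq (ncpoly K V)) :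
  lin F (flatten ps) = \sum_(p <- ps) lin F p.
Proof.
elim: ps => [|p ps IH]; first by rewrite big_nil lin_nil.
by rewrite big_cons lin_cat IH.
Qed.

Lemma eq_lin (M : lmodType K) (F G : seq V -> M) p :
  (forall t, t \in p -> F t.2 = G t.2) -> lin F p = lin G p.
Proof. by move=> eFG; apply: eq_big_seq => t tp; rewrite eFG. Qed.

Lemma lin_eq0 (M : lmodType K) (F : seq V -> M) p :
  (forall t, t \in p -> F t.2 = 0) -> lin F p = 0.
Proof.
by move=> F0; rewrite /lin big_seq big1 // => t tp; rewrite F0 ?scaler0.
Qed.

Lemma lin_mul (M : lmodType K) (F : seq V -> M) p q :
  lin F (ncmul p q) = lin (fun w1 => lin (fun w2 => F (w1 ++ w2)) q) p.
Proof.
rewrite /ncmul /lin big_allpairs_dep /=.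
apply: eq_bigr => s _; rewrite scaler_sumr.
by apply: eq_bigr => t _; rewrite scalerA.
Qed.

Lemma lin_context (M : lmodType K) (F : seq V -> M) w1 p w2 :
  lin F (ncmul (ncmul (ncword K w1) p) (ncword K w2)) =
  lin (fun w => F (w1 ++ w ++ w2)) p.
Proof.
by rewrite !lin_mul lin_word; apply: eq_lin => t _; rewrite lin_word catA.
Qed.

Lemma lin_map (M : lmodType K) (F : seq V -> M) (f : seq V -> seq V) p :
  lin F [seq (t.1, f t.2) | t <- p] = lin (fun w => F (f w)) p.
Proof. by rewrite /lin big_map. Qed.

Lemma lin_sum (M : lmodType K) (I : Type) (r : seq I) (F : I -> seq V -> M) p :
  lin (fun w => \sum_(i <- r) F i w) p = \sum_(i <- r) lin (F i) p.
Proof.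
rewrite /lin exchange_big; apply: eq_bigr => t _.
by rewrite scaler_sumr.
Qed.

Lemma lin_exchange (M : lmodType K) (F : seq V -> seq V -> M) p q :
  lin (fun w1 => lin (F w1) q) p = lin (fun w2 => lin (F^~ w2) p) q.
Proof.
rewrite [in LHS]/lin [in RHS]/lin.
rewrite (eq_bigr (fun s => \sum_(t <- q) s.1 *: (t.1 *: F s.2 t.2))); last first.
  by move=> s _; rewrite scaler_sumr.
rewrite exchange_big; apply: eq_bigr => t _; rewrite scaler_sumr.
by apply: eq_bigr => s _; rewrite !scalerA mulrC.
Qed.

Lemma coefnc_lin p w : coefnc p w = lin (fun w' => (w' == w)%:R : K^o) p.
Proof.
rewrite /coefnc /lin big_mkcond; apply: eq_bigr => t _.
by case: eqP => _; [rewrite [RHS]mulr1 | rewrite [RHS]mulr0].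
Qed.

Lemma lin_coefnc (M : lmodType K) (F : seq V -> M) p (ws : seq (seq V)) :
  uniq ws -> {subset [seq t.2 | t <- p] <= ws} ->
  lin F p = \sum_(w <- ws) coefnc p w *: F w.
Proof.
move=> uws; elim: p => [|t p IH] sub.
  by rewrite lin_nil big1 // => w _; rewrite /coefnc big_nil scale0r.
rewrite lin_cons IH; last by move=> w wp; apply: sub; rewrite inE wp orbT.
have tw : t.2 \in ws by apply: sub; rewrite inE eqxx.
rewrite (bigD1_seq t.2) //= [RHS](bigD1_seq t.2) //= addrA; congr (_ + _).
  by rewrite /coefnc big_cons eqxx scalerDl.
by apply: eq_bigr => w nw; rewrite /coefnc big_cons eq_sym (negbTE nw).
Qed.

Lemma nceq_lin (M : lmodType K) (F : seq V -> M) p q :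
  nceq p q -> lin F p = lin F q.
Proof.
move=> epq; set ws := undup ([seq t.2 | t <- p] ++ [seq t.2 | t <- q]).
rewrite (@lin_coefnc _ F p ws) ?undup_uniq //; last first.
  by move=> w wp; rewrite mem_undup mem_cat wp.
rewrite (@lin_coefnc _ F q ws) ?undup_uniq //; last first.
  by move=> w wp; rewrite mem_undup mem_cat wp orbT.
by apply: eq_bigr => w _; rewrite epq.
Qed.

Lemma lin_nceq p q :
  (forall F : seq V -> K^o, lin F p = lin F q) -> nceq p q.
Proof. by move=> e w; rewrite !coefnc_lin e. Qed.

End LinearExtension.

(** * Two-sided ideals *)

Section Ideals.
Variables (K : fieldType) (V : eqType) (S : ncpoly K V -> Prop).
Implicit Types (p q : ncpoly K V) (w : seq V).

Lemma in_ideal_lin p q :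
  (forall F : seq V -> K^o, lin F p = lin F q) -> in_ideal S p -> in_ideal S q.
Proof.
move=> /lin_nceq e [l [Sl el]]; exists l; split=> // w.
by rewrite -e el.
Qed.

Lemma in_ideal0 p : (forall F : seq V -> K^o, lin F p = 0) -> in_ideal S p.
Proof.
move=> p0; apply: (@in_ideal_lin [::]) => [F|]; first by rewrite lin_nil p0.
by exists [::].
Qed.

Lemma in_ideal_add p q :
  in_ideal S p -> in_ideal S q -> in_ideal S (ncadd p q).
Proof.
move=> [l [Sl el]] [l' [Sl' el']]; exists (l ++ l'); split=> [t|].
  by rewrite mem_cat => /orP[/Sl|/Sl'].
apply: lin_nceq => F.
by rewrite lin_add map_cat flatten_cat lin_cat (nceq_lin F el) (nceq_lin F el').
Qed.

Lemma in_ideal_mul a p b :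
  in_ideal S p -> in_ideal S (ncmul (ncmul a p) b).
Proof.
move=> [l [Sl el]].
exists [seq (ncmul a t.1.1, t.1.2, ncmul t.2 b) | t <- l]; split=> [t|].
  by case/mapP=> s /Sl Ss ->.
apply: lin_nceq => F; rewrite lin_flatten !big_map !lin_mul.
transitivity (lin (fun wa => \sum_(t <- l) lin (fun w => lin (fun wb =>
   F ((wa ++ w) ++ wb)) b) (ncmul (ncmul t.1.1 t.1.2) t.2)) a).
  by apply: eq_lin => t _; rewrite (nceq_lin _ el) lin_flatten big_map.
rewrite lin_sum; apply: eq_bigr => t _.
rewrite !lin_mul; apply: eq_lin => s _ /=.
rewrite !lin_mul; apply: eq_lin => s1 _.
apply: eq_lin => s2 _; rewrite lin_mul.
by apply: eq_lin => s3 _; apply: eq_lin => s4 _; rewrite !catA.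
Qed.

Lemma in_ideal_scale c p : in_ideal S p -> in_ideal S (ncscale c p).
Proof.
move/(@in_ideal_mul (ncconst V c) _ (ncconst V 1)); apply: in_ideal_lin => F.
rewrite !lin_mul lin_cons lin_nil addr0 lin_scale; congr (_ *: _).
by apply: eq_lin => t _; rewrite lin_cons lin_nil addr0 scale1r cats0.
Qed.

Lemma in_ideal_gen p : S p -> in_ideal S p.
Proof.
move=> Sp; exists [:: (ncconst V 1, p, ncconst V 1)]; split=> [t|].
  by rewrite inE => /eqP ->.
apply: lin_nceq => F; rewrite /= cats0 !lin_mul lin_cons lin_nil addr0 scale1r.
by apply: eq_lin => t _; rewrite lin_cons lin_nil addr0 scale1r cats0.
Qed.

(** Expanding both cofactors into words reduces each summand [a s b] to contexts [w1 s w2]; the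
    exchange of sums makes the one over [s] innermost. *)
Lemma lin_in_ideal (M : lmodType K) (F : seq V -> M) p :
  (forall s w1 w2, S s -> lin (fun w => F (w1 ++ w ++ w2)) s = 0) ->
  in_ideal S p -> lin F p = 0.
Proof.
move=> FS [l [Sl /(nceq_lin F) ->]]; rewrite lin_flatten big_map.
rewrite big_seq big1 // => -[[a s] b] /Sl /= Ss; rewrite !lin_mul.
apply: lin_eq0 => t _; rewrite lin_exchange.
apply: lin_eq0 => r _; rewrite -(FS s t.2 r.2 Ss).
by apply: eq_lin => ? _; rewrite catA.
Qed.

End Ideals.

(** * Normal words and the weight that makes rewriting terminate *)

Section NormalWords.
Variables (V : eqType) (idx : V -> nat) (n : nat).
Hypothesis idx_inj : injective idx.
Hypothesis idx_le : forall x, (idx x <= n)%N.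

Definition normal_pair (a b : V) : bool := (idx a == 0%N) || (idx b == n).

Definition wsum (w : seq V) : nat := sumn (map idx w).

(* The relations rewrite a word to words of smaller weight: letters are weighted
   by their position counted from the right. *)
Fixpoint weight (w : seq V) : nat :=
  if w is x :: w' then (idx x * size w + weight w')%N else 0%N.

Lemma wsum_le w : (wsum w <= n * size w)%N.
Proof.
elim: w => //= x w IH; rewrite /wsum /= mulnS.
by apply: leq_add.
Qed.

(** After a letter of nonzero index, normality forces index [n], which is again nonzero; hence every
    later letter has index [n]. *)
Lemma normal_cons x w :
  sorted normal_pair (x :: w) -> (0 < idx x)%N -> wsum w = (n * size w)%N.
Proof.
elim: w x => [|y w IH] x /=; first by rewrite muln0.
case/andP=> /orP[/eqP ->//|/eqP ey] pw x0.
rewrite /wsum /= ey mulnS; congr addn.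
case: w IH pw => [|z w] IH pw; first by rewrite muln0.
apply: (IH y) => //; move: (idx_le x); lia.
Qed.

(** A nonzero first letter forces the maximal sum on the rest of the word, so length and sum
    determine the first letter, then the rest by induction. *)
Lemma normal_inj w1 w2 :
  sorted normal_pair w1 -> sorted normal_pair w2 -> size w1 = size w2 ->
  wsum w1 = wsum w2 -> w1 = w2.
Proof.
elim: w1 w2 => [|x w1 IH] [|y w2] // s1 s2 [es] e.
have s1' := path_sorted s1; have s2' := path_sorted s2.
have l1 := wsum_le w1; have l2 := wsum_le w2.
have exy : idx x = idx y.
  move: e; rewrite /wsum /= -/(wsum w1) -/(wsum w2).
  have h1 := normal_cons s1; have h2 := normal_cons s2.
  rewrite es in l1 h1 h2 *.
  have [x0|x0] := posnP (idx x); have [y0|y0] := posnP (idx y); first lia.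
  - by rewrite (h2 y0); lia.
  - by rewrite (h1 x0); lia.
  - by rewrite (h1 x0) (h2 y0); lia.
move: e; rewrite /wsum /= exy => /addnI e.
by rewrite (idx_inj exy) (IH w2).
Qed.

Lemma non_normal_split w : ~~ sorted normal_pair w ->
  exists w1 a b w2, w = w1 ++ [:: a; b] ++ w2 /\ ~~ normal_pair a b.
Proof.
elim: w => [//|x [//|y w] IH] /=.
rewrite negb_and; have [nxy _|/= /negbNE _ /IH] := boolP (~~ normal_pair x y).
  by exists [::], x, y, w.
by move=> [w1 [a [b [w2 [-> nab]]]]]; exists (x :: w1), a, b, w2.
Qed.

(** With [s] letters to its right, the pair [a b] contributes [s (a + b) + (2 a + b)]: the first
    inequality bounds the multiple of [s], the second gives strictness. The letters of [w1] keep
    their positions. *)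
Lemma weight_context w1 a b c d w2 :
  (idx c + idx d <= idx a + idx b)%N ->
  (2 * idx c + idx d < 2 * idx a + idx b)%N ->
  (weight (w1 ++ [:: c; d] ++ w2) < weight (w1 ++ [:: a; b] ++ w2))%N.
Proof.
move=> h1 h2; elim: w1 => [|x w1 IH] /=; first nia.
by rewrite !size_cat /= ltn_add2l.
Qed.

End NormalWords.

(** * Ideal membership decided by a polynomial model *)

Section IdealMembership.
Variables (K : fieldType) (V : eqType) (idx : V -> nat) (n : nat).
Variables (S : ncpoly K V -> Prop) (A : V -> nat -> {poly K}).
Hypothesis idx_inj : injective idx.
Hypothesis idx_le : forall x, (idx x <= n)%N.
Hypothesis size_A : forall x N, size (A x N) = (idx x).+1.

(* The image of [w] when a word of length [N] stands to its right; [A x N] is the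
   factor contributed by the letter [x] followed by [N] letters. *)
Fixpoint wpoly (N : nat) (w : seq V) : {poly K} :=
  if w is x :: w' then A x (N + size w') * wpoly N w' else 1.

(** [wpoly] forgets the length of a word; selecting one length [m] restores the grading. *)
Definition grpoly (m : nat) (w : seq V) : {poly K} :=
  if size w == m then wpoly 0 w else 0.

Lemma wpoly_cat N w1 w2 :
  wpoly N (w1 ++ w2) = wpoly (N + size w2) w1 * wpoly N w2.
Proof.
elim: w1 => [|x w1 IH] /=; first by rewrite mul1r.
by rewrite IH mulrA size_cat addnAC addnA.
Qed.

Lemma size_wpoly N w : size (wpoly N w) = (wsum idx w).+1.
Proof.
elim: w => [|x w IH]; first by rewrite size_poly1.
have nz (r : {poly K}) k : size r = k.+1 -> r != 0.
  by move=> e; rewrite -size_poly_eq0 e.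
by rewrite /= size_mul ?(nz _ _ IH) ?(nz _ _ (size_A _ _)) // size_A IH /= addnS.
Qed.

Hypothesis S_quadratic : forall s t, S s -> t \in s -> size t.2 = 2%N.
Hypothesis S_wpoly : forall s N, S s -> lin (wpoly N) s = 0.
Hypothesis S_rewrite : forall a b, ~~ normal_pair idx n a b ->
  exists q : ncpoly K V,
    (forall t, t \in q -> exists c d, [/\ t.2 = [:: c; d],
       (idx c + idx d <= idx a + idx b)%N &
       (2 * idx c + idx d < 2 * idx a + idx b)%N]) /\
    in_ideal S (ncsub (ncword K [:: a; b]) q).

(** Generators are quadratic, so in a context all their terms have the same length and share the
    factors coming from the context; [S_wpoly] kills what remains. *)
Lemma in_ideal_grpoly p m : in_ideal S p -> lin (grpoly m) p = 0.
Proof.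
apply: lin_in_ideal => s w1 w2 Ss.
have [em|nem] := eqVneq (size w1 + (2 + size w2))%N m; last first.
  apply: lin_eq0 => t ts.
  by rewrite /grpoly !size_cat (S_quadratic Ss ts) (negbTE nem).
transitivity (lin (fun w => wpoly (2 + size w2) w1 * wpoly (size w2) w
                            * wpoly 0 w2) s).
  apply: eq_lin => t ts; rewrite /grpoly !size_cat (S_quadratic Ss ts) em eqxx.
  by rewrite !wpoly_cat mulrA size_cat (S_quadratic Ss ts).
transitivity (wpoly (2 + size w2) w1 * lin (wpoly (size w2)) s * wpoly 0 w2).
  rewrite /lin mulr_sumr mulr_suml; apply: eq_bigr => t _.
  by rewrite scalerAl scalerAr.
by rewrite S_wpoly // mulr0 mul0r.
Qed.

Definition normal_poly (q : ncpoly K V) :=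
  forall t, t \in q -> sorted (normal_pair idx n) t.2.

Lemma normal_form_lift (q : ncpoly K V) :
  (forall t, t \in q -> exists r, normal_poly r /\
      in_ideal S (ncsub (ncword K t.2) r)) ->
  exists r, normal_poly r /\ in_ideal S (ncsub q r).
Proof.
elim: q => [_|[c w] q IH hq].
  exists [::]; split=> //; apply: in_ideal0 => F.
  by rewrite lin_sub subrr.
have [r [nr ir]] := hq (c, w) (mem_head _ _).
have [|r' [nr' ir']] := IH; first by move=> t tq; apply: hq; rewrite inE tq orbT.
exists (ncadd (ncscale c r) r'); split=> [t|].
  by rewrite mem_cat => /orP[/mapP[t' /nr ? ->]|/nr'].
apply: in_ideal_lin (in_ideal_add (in_ideal_scale c ir) ir') => F.
rewrite lin_add lin_scale !lin_sub lin_add lin_scale lin_word lin_cons /=.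
by rewrite scalerBr opprD addrACA.
Qed.

(** Induction on [weight]: rewriting a non-normal pair inside its context yields lighter words. *)
Lemma normal_form_word w :
  exists r, normal_poly r /\ in_ideal S (ncsub (ncword K w) r).
Proof.
have [k] := ubnP (weight idx w); elim: k w => // k IH w lek.
have [nw|/non_normal_split[w1 [a [b [w2 [ew nab]]]]]] :=
  boolP (sorted (normal_pair idx n) w).
  exists (ncword K w); split; first by move=> t; rewrite inE => /eqP ->.
  by apply: in_ideal0 => F; rewrite lin_sub subrr.
have [q [hq iq]] := S_rewrite nab.
have [|r [nr ir]] := @normal_form_lift [seq (t.1, w1 ++ t.2 ++ w2) | t <- q].
  move=> _ /mapP[t /hq[c [d [etc le1 le2]]] ->] /=; apply: IH.
  rewrite etc; apply: leq_trans (weight_context w1 w2 le1 le2) _.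
  by rewrite -ew -ltnS.
exists r; split=> //.
have := in_ideal_add (in_ideal_mul (ncword K w1) (ncword K w2) iq) ir.
apply: in_ideal_lin => F.
rewrite lin_add lin_context !lin_sub !lin_word.
by rewrite (lin_map F (fun v => w1 ++ v ++ w2)) ew addrA subrK.
Qed.

Lemma normal_form p :
  exists r, normal_poly r /\ in_ideal S (ncsub p r).
Proof. by apply: normal_form_lift => t _; apply: normal_form_word. Qed.

(** Leading terms: [wpoly 0 w] has degree [wsum idx w], and normal words of one length have distinct
    sums, so a word of largest sum in the support cannot be cancelled. *)
Lemma normal_poly_eq0 r : normal_poly r ->
  (forall m, lin (grpoly m) r = 0) -> nceq r [::].
Proof.
move=> nr r0 w0; rewrite [RHS]/coefnc big_nil; apply/eqP/negPn/negP => c0.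
pose ws := undup [seq t.2 | t <- r].
pose supp w := (coefnc r w != 0) && (size w == size w0).
have supp_ws w : supp w -> w \in ws.
  case/andP=> cw _; rewrite mem_undup; apply: contraNT cw => nw.
  rewrite /coefnc big_seq_cond big1 // => t /andP[tr /eqP et].
  by rewrite -et map_f in nw.
have ws_normal w : w \in ws -> sorted (normal_pair idx n) w.
  by rewrite mem_undup => /mapP[t /nr ? ->].
have [w [sw wmax]] : exists w, supp w /\
    forall w', supp w' -> (wsum idx w' <= wsum idx w)%N.
  have ex : exists k, has (fun w => supp w && (wsum idx w == k)) ws.
    exists (wsum idx w0); apply/hasP; exists w0; last by rewrite /supp c0 !eqxx.
    by apply: supp_ws; rewrite /supp c0 eqxx.
  have bd k : has (fun w => supp w && (wsum idx w == k)) ws ->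
      (k <= n * size w0)%N.
    by case/hasP=> w _ /andP[/andP[_ /eqP <-] /eqP <-]; apply: wsum_le.
  case: (ex_maxnP ex bd) => k /hasP[w _ /andP[sw /eqP <-]] kmax.
  exists w; split=> // w' sw'; apply: kmax; apply/hasP; exists w'.
    exact: supp_ws.
  by rewrite sw' eqxx.
have /(congr1 (fun q : {poly K} => q`_(wsum idx w))) := r0 (size w0).
have sub : {subset [seq t.2 | t <- r] <= ws} by move=> v; rewrite mem_undup.
rewrite (lin_coefnc _ (undup_uniq _) sub) coef_sum coef0.
rewrite (bigD1_seq w) ?undup_uniq ?supp_ws //= big_seq_cond big1 ?addr0.
  move/eqP; case/andP: (sw) => cw /eqP ews.
  rewrite coefZ mulf_eq0 (negbTE cw) /= /grpoly ews eqxx.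
  rewrite -[wsum idx w]/((wsum idx w).+1.-1) -(size_wpoly 0 w) -lead_coefE.
  by rewrite lead_coef_eq0 -size_poly_eq0 size_wpoly.
(* Any other word has the wrong length, coefficient zero, or an image of strictly smaller degree. *)
move=> v /andP[vws nvw]; rewrite coefZ /grpoly.
have [evs|nes] := eqVneq (size v) (size w0); last by rewrite coef0 mulr0.
have [->|cv] := eqVneq (coefnc r v) 0; first by rewrite mul0r.
have sv : supp v by rewrite /supp cv evs eqxx.
rewrite nth_default ?mulr0 // size_wpoly ltn_neqAle wmax // andbT.
apply: contraNneq nvw => e; apply/eqP.
apply: (normal_inj idx_inj idx_le (ws_normal _ vws) (ws_normal _ _)) => //.
  exact: supp_ws.
by case/andP: sw => _ /eqP ->.
Qed.

(** If the model kills [p], it also kills a normal form of [p], which is then zero. *)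
Theorem in_idealP p : in_ideal S p <-> forall m, lin (grpoly m) p = 0.
Proof.
split=> [ip m|p0]; first exact: in_ideal_grpoly.
have [r [nr ir]] := normal_form p.
have r0 : nceq r [::].
  apply: normal_poly_eq0 => // m; have := in_ideal_grpoly m ir.
  by rewrite lin_sub p0 sub0r => /eqP; rewrite oppr_eq0 => /eqP.
apply: in_ideal_lin ir => F.
by rewrite lin_sub (nceq_lin F r0) lin_nil subr0.
Qed.

End IdealMembership.

(** * Binomial coefficients as polynomials, in characteristic zero *)

Section BinomialPolynomials.
Variable K : fieldType.
Hypothesis charK : [pchar K] =i pred0.
Implicit Types y : {poly K}.

Definition binpoly (i : nat) y : {poly K} :=
  (i`!%:R)^-1 *: \prod_(k < i) (y - k%:R).

Lemma natr_neq0 k : (k.+1%:R : K) != 0.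
Proof. by have /pcharf0P -> := charK. Qed.

Lemma factr_neq0 i : (i`!%:R : K) != 0.
Proof. by have := fact_gt0 i; case: (i`!) => // k _; apply: natr_neq0. Qed.

Lemma binpoly0 y : binpoly 0 y = 1.
Proof. by rewrite /binpoly big_ord0 fact0 invr1 scale1r. Qed.

Lemma binpolyS i y : i.+1%:R *: binpoly i.+1 y = binpoly i y * (y - i%:R).
Proof.
rewrite /binpoly scalerA factS natrM invfM mulrA mulfV ?natr_neq0 // mul1r.
by rewrite big_ord_recr /= -scalerAl.
Qed.

Lemma binpoly_pascal j y :
  binpoly j.+1 (y + 1) = binpoly j.+1 y + binpoly j y.
Proof.
apply: (scalerI (natr_neq0 j)); rewrite scalerDr [in RHS]binpolyS.
rewrite {1}/binpoly scalerA factS natrM invfM mulrA mulfV ?natr_neq0 // mul1r.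
(* Splitting off the first factor [y + 1] leaves the falling product of [y]. *)
rewrite big_ord_recl subr0 (eq_bigr (fun k : 'I_j => y - k%:R)); last first.
  by move=> k _; rewrite lift0 -natr1; ring.
rewrite scalerAr -/(binpoly j y) scaler_nat -[binpoly j y *+ _]mulr_natr -natr1.
by ring.
Qed.

(** Induction on [r], matching Pascal's rule for ['C(r.+1, k)] with [binpoly_pascal]. *)
Lemma binpoly_vandermonde r j y :
  \sum_(k < j.+1) 'C(r, k)%:R *: binpoly (j - k) y = binpoly j (y + r%:R).
Proof.
elim: r j => [|r IH] [|j].
- by rewrite big_ord1 bin0 scale1r !binpoly0.
- rewrite big_ord_recl bin0 scale1r subn0 addr0 big1 ?addr0 // => k _.
  by rewrite bin0n scale0r.
- by rewrite big_ord1 bin0 scale1r !binpoly0.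
rewrite -natr1 addrA binpoly_pascal -!IH big_ord_recl [in RHS]big_ord_recl.
rewrite !bin0 -addrA; congr (_ + _); rewrite -big_split.
by apply: eq_bigr => k _; rewrite /= /bump /= subSS binS natrD scalerDl.
Qed.

(** The right side is symmetric in [i] and [j]; this symmetry is the source of the first family of
    relations. *)
Lemma binpoly_mul i j y :
  binpoly i y * binpoly j (y - i%:R) =
  (i`!%:R^-1 * j`!%:R^-1) *: \prod_(k < i + j) (y - k%:R).
Proof.
rewrite /binpoly -scalerAl -scalerAr scalerA big_split_ord /=; congr (_ *: (_ * _)).
by apply: eq_bigr => k _; rewrite natrD; ring.
Qed.

Lemma size_binpoly i c : size (binpoly i ('X - c%:R)) = i.+1.
Proof.
rewrite /binpoly size_scale ?invr_eq0 ?factr_neq0 //.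
rewrite (eq_bigr (fun k : 'I_i => 'X - ((c + k)%:R)%:P)); last first.
  by move=> k _; rewrite polyC_natr natrD; ring.
by rewrite size_prod_XsubC /index_enum -enumT size_enum_ord.
Qed.

End BinomialPolynomials.

(** * The polynomial model of the Jordan plane *)

Section JordanPlane.
Variable K : fieldType.

(* ['X] stands for [theta]; dropping the power of [t] and rescaling by [-1] in
   odd degrees turns [u] into [1] and [v] into [- theta]. *)
Definition jordan_factor (x : bool) (N : nat) : {poly K} :=
  if x then N%:R - 'X else 1.

Lemma size_jordan_factor x N : size (jordan_factor x N) = (nat_of_bool x).+1.
Proof.
case: x; rewrite /jordan_factor ?size_poly1 //.
by rewrite -opprB size_polyN -polyC_natr size_XsubC.
Qed.

Lemma size_wpoly_jordan N w :
  (size (wpoly jordan_factor N w) <= (size w).+1)%N.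
Proof.
rewrite (size_wpoly size_jordan_factor) ltnS -[size w]mul1n.
by apply: wsum_le; case.
Qed.

Lemma wpoly_uv N a i :
  wpoly jordan_factor N (nseq a lu ++ nseq i lv) =
  (-1) ^+ i *: \prod_(k < i) ('X - (N + k)%:R).
Proof.
elim: a => [|a IH] /=; last by rewrite mul1r.
elim: i => [|i IH]; first by rewrite big_ord0 scale1r.
rewrite /= size_nseq IH big_ord_recr exprS -scalerA scaleN1r /= -scalerAr -scalerN.
by congr (_ *: _); ring.
Qed.

(** The criterion with [u], [v] of index 0, 1: only [v u] is not normal, and the relation holds
    because [(N + 1 - theta) - (N - theta) - 1 = 0]. *)
Lemma inJP (f : ncpoly K bool) :
  inJ f <-> forall m, lin (grpoly jordan_factor m) f = 0.
Proof.
apply: (@in_idealP K bool nat_of_bool 1).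
- by case=> [] [].
- by case.
- exact: size_jordan_factor.
- by move=> s t ->; rewrite !inE => /or3P[] /eqP ->.
- move=> s N ->; rewrite !lin_sub !lin_word /= !addn1 !addn0 -natr1.
  by ring.
- case=> -[] //= _.
  exists (ncadd (ncword K [:: lu; lv]) (ncword K [:: lu; lu])); split.
    move=> t; rewrite !inE => /orP[] /eqP -> /=.
      by exists lu, lv.
    by exists lu, lu.
  have jr : in_ideal (fun q => q = jrel K) (jrel K) by apply: in_ideal_gen.
  apply: in_ideal_lin jr => F.
  by rewrite !lin_sub.
Qed.

End JordanPlane.

(** * The relations between the generators of the Veronese subring *)

Section Veronese.
Variables (K : fieldType) (n : nat).
Hypothesis charK : [pchar K] =i pred0.

(** [N] generators to the right amount to [n * N] letters [u], [v], whence the shift of [theta]. The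
    sign of [xgen] cancels the one from [v] acting as [- theta]. *)
Definition veronese_factor (i : 'I_n.+1) (N : nat) : {poly K} :=
  binpoly i ('X - (n * N)%:R).

Lemma lin_mulX (M : lmodType K) (F : seq 'I_n.+1 -> M) a b :
  lin F (ncmul (X K n a) (X K n b)) = F [:: inord a; inord b].
Proof. by rewrite lin_mul !lin_word. Qed.

Lemma lin_rel1 (M : lmodType K) (F : seq 'I_n.+1 -> M) i j :
  lin F (rel1 K n i j) =
  \sum_(k < j.+1) 'C(n - i, k)%:R *: F [:: inord (j - k); inord i] -
  \sum_(l < i.+1) 'C(n - j, l)%:R *: F [:: inord (i - l); inord j].
Proof.
have iotaE b : iota 0 b = index_iota 0 b by rewrite /index_iota subn0.
rewrite lin_sub !lin_flatten !big_map !iotaE !big_mkord.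
by congr (_ - _); apply: eq_bigr => k _; rewrite lin_scale lin_mulX.
Qed.

Lemma lin_rel2 (M : lmodType K) (F : seq 'I_n.+1 -> M) i j :
  lin F (rel2 K n i j) =
  i%:R *: F [:: inord i; inord j] - j.+1%:R *: F [:: inord i.-1; inord j.+1]
  + (n.-1 - (j - i))%:R *: F [:: inord i.-1; inord j].
Proof. by rewrite lin_add lin_sub !lin_scale !lin_mulX. Qed.

Lemma wpoly_rel1 i j N : (i < j <= n)%N ->
  lin (wpoly veronese_factor N) (rel1 K n i j) = 0.
Proof.
move=> /andP[ij jn]; rewrite lin_rel1 /= /veronese_factor.
set z := 'X - (n * (N + 0))%:R.
(* Vandermonde turns each half of the relation into a product that [binpoly_mul] shows to be
   symmetric in [a] and [b]. *)
have half a b : (a <= n)%N -> (b <= n)%N ->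
    \sum_(k < b.+1) 'C(n - a, k)%:R *:
      (binpoly (inord (b - k) : 'I_n.+1) ('X - (n * (N + 1))%:R) *
       (binpoly (inord a : 'I_n.+1) z * 1)) =
    binpoly a z * binpoly b (z - a%:R).
  move=> an bn; rewrite inordK // mulr1 mulrC.
  have -> : z - a%:R = ('X - (n * (N + 1))%:R) + (n - a)%:R.
    by rewrite /z natrB // addn0 mulnDr muln1 natrD; ring.
  rewrite -binpoly_vandermonde // mulr_suml; apply: eq_bigr => k _.
  by rewrite inordK ?scalerAl // ltnS (leq_trans (leq_subr _ _)).
rewrite !half //; last by apply: leq_trans jn; apply: ltnW.
  by rewrite !binpoly_mul addnC [_^-1 * _]mulrC subrr.
by apply: leq_trans jn; apply: ltnW.
Qed.

(** By [binpolyS] all three terms are multiples of [binom(y, i-1) binom(y+n, j)], where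
    [y = theta - n (N+1)]; the cofactors [(y-i+1) - (y+n-j) + (n-1-(j-i))] add up to zero. *)
Lemma wpoly_rel2 i j N : (0 < i)%N -> (i <= j)%N -> (j < n)%N ->
  lin (wpoly veronese_factor N) (rel2 K n i j) = 0.
Proof.
case: i => // i _ ij jn; rewrite lin_rel2 /= /veronese_factor !inordK; try lia.
rewrite !mulr1 addn0 addn1 mulnS scalerAl binpolyS // scalerAr binpolyS //.
(* The truncated subtractions are exact since [i.+1 <= j < n]. *)
have -> : ((n.-1 - (j - i.+1))%:R : K) = n%:R - j%:R + i%:R.
  by rewrite -natrB -?natrD; [congr (_%:R); lia | lia].
rewrite !scalerDl scaleNr !scaler_nat natrD.
by ring.
Qed.

Lemma relI_rewrite (a b : 'I_n.+1) : ~~ normal_pair (@nat_of_ord n.+1) n a b ->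
  exists q : ncpoly K 'I_n.+1,
    (forall t, t \in q -> exists c d, [/\ t.2 = [:: c; d],
       (c + d <= a + b)%N & (2 * c + d < 2 * a + b)%N]) /\
    in_ideal (@relI K n) (ncsub (ncword K [:: a; b]) q).
Proof.
rewrite /normal_pair negb_or => /andP[a0 bn].
have [an bn'] := (ltn_ord a, ltn_ord b).
have [ab|ba] := leqP a b.
  (* The second family solved for [X_a X_b], dividing by the nonzero [a]. *)
  exists (ncadd (ncscale (b.+1%:R / a%:R) (ncword K [:: inord a.-1; inord b.+1]))
    (ncscale (- (n.-1 - (b - a))%:R / a%:R) (ncword K [:: inord a.-1; b]))); split.
    move=> t; rewrite !inE => /orP[] /eqP -> /=; eexists; eexists; split=> //;
      by rewrite !inordK; lia.
  have r : relI (rel2 K n a b) by right; exists a, b; do !split=> //; lia.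
  apply: in_ideal_lin (in_ideal_scale a%:R^-1 (in_ideal_gen r)) => F.
  rewrite lin_scale lin_rel2 lin_sub lin_add !lin_scale !lin_word !inord_val.
  have a0' : (a%:R : K) != 0 by case: (nat_of_ord a) a0 => // k _; apply: natr_neq0.
  rewrite scalerDr scalerBr !scalerA mulVf // scale1r opprD addrA.
  by rewrite mulNr scaleNr opprK ![_ * a%:R^-1]mulrC.
(* The first family at [i = b], [j = a], solved for its term [k = 0], which is [X_a X_b]; the
   remaining terms are indexed by [k.+1]. *)
exists (ncsub [seq ('C(n - a, l)%:R, [:: inord (b - l); a]) | l : 'I_b.+1 <- index_enum 'I_b.+1]
   [seq ('C(n - b, k.+1)%:R, [:: inord (a - k.+1); b]) | k : 'I_a <- index_enum 'I_a]); split.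
  move=> t; rewrite mem_cat => /orP[/mapP[l _ ->]|/mapP[_ /mapP[k _ ->] ->]] /=;
    eexists; eexists; split=> //; rewrite inordK; try lia;
    by case: l || case: k => /= *; lia.
have r : relI (rel1 K n b a) by left; exists b, a; do !split=> //; lia.
apply: in_ideal_lin (in_ideal_gen r) => F.
rewrite lin_rel1 !lin_sub lin_word big_ord_recl bin0 scale1r subn0 !inord_val.
rewrite /lin !big_map /= opprB addrA.
by congr (_ - _).
Qed.

Lemma relIP (p : ncpoly K 'I_n.+1) :
  in_ideal (@relI K n) p <-> forall m, lin (grpoly veronese_factor m) p = 0.
Proof.
apply: (@in_idealP K 'I_n.+1 (@nat_of_ord n.+1) n).
- exact: val_inj.
- by move=> x; rewrite -ltnS.
- by move=> x N; apply: size_binpoly.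
- move=> s t [[i [j [_ [_ ->]]]]|[i [j [_ [_ [_ ->]]]]]].
    rewrite mem_cat => /orP[|/mapP[t' + ->] /=];
      by case/flattenP=> _ /mapP[k _ ->]; rewrite inE => /eqP ->.
  by rewrite !inE => /or3P[] /eqP ->.
- move=> s N [[i [j [ij [jn ->]]]]|[i [j [i0 [ij [jn ->]]]]]].
    by apply: wpoly_rel1; rewrite ij.
  exact: wpoly_rel2.
- exact: relI_rewrite.
Qed.

(** * Evaluation of the generators in the Jordan plane, and surjectivity *)

Fixpoint xword (w : seq 'I_n.+1) : seq bool :=
  if w is i :: w' then (nseq (n - i) lu ++ nseq i lv) ++ xword w' else [::].

(** The factor [1] is the one left by [ncscale] on a word, so that evaluation matches by
    computation. *)
Fixpoint xcoef (w : seq 'I_n.+1) : K :=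
  if w is i :: w' then (-1) ^+ i / i`!%:R * 1 * xcoef w' else 1.

Lemma ncevalword_xgen w :
  ncevalword (@xgen K n) w = [:: (xcoef w, xword w)].
Proof. by elim: w => //= i w ->. Qed.

Lemma size_xword w : size (xword w) = (n * size w)%N.
Proof.
elim: w => [|i w IH] /=; first by rewrite muln0.
by rewrite !size_cat !size_nseq IH subnK ?mulnS // -ltnS.
Qed.

Lemma wpoly_xword w :
  xcoef w *: wpoly (@jordan_factor K) 0 (xword w) = wpoly veronese_factor 0 w.
Proof.
elim: w => [|i w IH] /=; first by rewrite scale1r.
rewrite wpoly_cat size_xword !add0n mulr1 wpoly_uv -IH.
rewrite /veronese_factor /binpoly -!scalerAl -!scalerAr !scalerA.
congr (_ *: (_ * _)).
  by rewrite mulrC !mulrA -expr2 sqrr_sign mul1r.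
by apply: eq_bigr => k _; rewrite natrD opprD addrA.
Qed.

(** A word of length [k] evaluates to a multiple of a word of length [n * k], so only degrees
    divisible by [n] occur. *)
Lemma lin_xgen m (p : ncpoly K 'I_n.+1) : (0 < n)%N ->
  lin (grpoly (@jordan_factor K) m) (nceval (@xgen K n) p) =
  if (n %| m)%N then lin (grpoly veronese_factor (m %/ n)) p else 0.
Proof.
move=> n0; rewrite lin_flatten big_map.
transitivity (\sum_(t <- p) t.1 *: (xcoef t.2 *:
                  grpoly (@jordan_factor K) m (xword t.2))).
  by apply: eq_bigr => t _; rewrite lin_scale ncevalword_xgen lin_cons lin_nil addr0.
rewrite /grpoly; case: ifPn => [/dvdnP[k ->]|nm].
  apply: eq_bigr => t _; rewrite mulnK // size_xword mulnC eqn_pmul2r //.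
  by case: eqP => _; rewrite ?scaler0 // wpoly_xword.
rewrite big1 // => t _; case: eqP => [e|_]; last by rewrite !scaler0.
by rewrite -e size_xword dvdn_mulr in nm.
Qed.

Lemma exists_word m s : (s <= n * m)%N ->
  exists w : seq 'I_n.+1, size w = m /\ wsum (@nat_of_ord n.+1) w = s.
Proof.
elim: m s => [|m IH] s; first by rewrite muln0 leqn0 => /eqP ->; exists [::].
(* Greedy choice: the first letter takes as much of [s] as an index allows. *)
rewrite mulnS => le; have [|w [<- ew]] := IH (s - minn s n)%N; first lia.
exists (inord (minn s n) :: w); split=> //.
by rewrite /wsum /= -/(wsum _ w) ew inordK; lia.
Qed.

(** Triangularity: every degree up to [n * m] is attained by the image of a word of length [m], so
    leading terms are removed one at a time. *)
Lemma veronese_surj m (q : {poly K}) : (size q <= (n * m).+1)%N ->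
  exists p : ncpoly K 'I_n.+1,
    forall k, lin (grpoly veronese_factor k) p = if m == k then q else 0.
Proof.
have [k] := ubnPleq (size q); elim: k q => [|k IH] q szq lekm.
  exists [::] => j; move: szq; rewrite leqn0 size_poly_eq0 => /eqP ->.
  by rewrite lin_nil if_same.
have [w [sw ew]] := exists_word lekm.
pose T := wpoly veronese_factor 0 w.
have sT : size T = k.+1.
  by rewrite (@size_wpoly K _ (@nat_of_ord n.+1)) ?ew // => x N; apply: size_binpoly.
pose c := q`_k / T`_k.
have Tk : T`_k != 0.
  by rewrite -[k]/(k.+1.-1) -sT -lead_coefE lead_coef_eq0 -size_poly_eq0 sT.
have sz : (size (q - c *: T)%R <= k)%N.
  apply/leq_sizeP => j; rewrite leq_eqVlt coefB coefZ => /orP[/eqP <-|kj].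
    by rewrite /c divfK // subrr.
  by rewrite !nth_default ?sT ?(leq_trans szq) // mulr0 subrr.
have [p hp] := IH _ sz (ltnW lekm).
exists (ncadd p (ncscale c (ncword K w))) => j.
rewrite lin_add hp lin_scale lin_word /grpoly sw.
by case: eqP => _; rewrite ?subrK // scaler0 addr0.
Qed.

End Veronese.

(** * The image is the Veronese subring, and the presentation follows *)

Lemma in_veroneseP (K : fieldType) (n : nat) (f : ncpoly K bool) :
  [pchar K] =i pred0 -> (0 < n)%N ->
  in_veronese n f <->
  exists p : ncpoly K 'I_n.+1, inJ (ncsub f (nceval (@xgen K n) p)).
Proof.
move=> charK n0; split=> [[g [g0 fg]]|[p fp]]; last first.
  exists (nceval (@xgen K n) p); split=> // w nw.
  rewrite /coefnc big_seq_cond big1 // => t /andP[/flattenP[_ /mapP[s _ ->]]].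
  rewrite ncevalword_xgen inE => /eqP -> /= /eqP e.
  by rewrite -e size_xword dvdn_mulr in nw.
(* Terms of [g] of length not divisible by [n] cancel but may occur in the list; [g'] discards
   them. *)
pose g' := [seq t <- g | n %| size t.2]%N.
have gg' : nceq g g'.
  move=> w; rewrite /coefnc big_filter_cond.
  have [dw|ndw] := boolP (n %| size w)%N.
    by apply: eq_bigl => t; rewrite andbC; case: eqP => //= ->.
  have := g0 _ ndw; rewrite /coefnc => ->; rewrite big1 // => t /andP[dt /eqP e].
  by rewrite e (negbTE ndw) in dt.
(* A preimage in the model is built word by word: a word of length [k * n] has an image of degree at
   most [n * k]. *)
have [p hp] : exists p : ncpoly K 'I_n.+1, forall m,
    lin (grpoly (@jordan_factor K) m) (nceval (@xgen K n) p) =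
    lin (grpoly (@jordan_factor K) m) g'.
  rewrite /g'; elim: (g) => [|[c w] h [p hp]] /=.
    by exists [::] => m; rewrite /= !lin_nil.
  case: ifP => [/dvdnP[k ek]|_]; last by exists p.
  have [|p' hp'] := @veronese_surj K n charK k (wpoly (@jordan_factor K) 0 w).
    by rewrite mulnC -ek size_wpoly_jordan.
  exists (ncadd (ncscale c p') p) => m; rewrite lin_cons -hp !lin_xgen //.
  rewrite /grpoly ek.
  case: ifPn => [/dvdnP[l ->]|nm].
    rewrite mulnK // lin_add lin_scale hp' eqn_pmul2r //.
  rewrite addr0; case: eqP => [e|_]; last by rewrite scaler0.
  by rewrite -e dvdn_mull in nm.
exists p; apply/inJP => m; rewrite lin_sub hp -(nceq_lin _ gg').
by move/inJP: fg => /(_ m); rewrite lin_sub.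
Qed.

(* The algebra map phi : K<X_0..X_n> -> K_J[u,v], X_i |-> (-1)^i/i! u^(n-i) v^i,
   has kernel exactly I and image exactly the Veronese subring; hence it induces
   K<X_0..X_n>/I ~= K_J[u,v]^G. *)
Theorem mainTheorem12 (K : closedFieldType) (hK : [pchar K] =i pred0)
  (n : nat) (hn : (2 <= n)%N) :
  (forall p : ncpoly K 'I_n.+1,
      inJ (nceval (@xgen K n) p) <-> in_ideal (@relI K n) p) /\
  (forall f : ncpoly K bool,
      in_veronese n f <-> exists p : ncpoly K 'I_n.+1, inJ (ncsub f (nceval (@xgen K n) p))).
Proof.
have n0 : (0 < n)%N by apply: ltnW.
split=> [p|f]; last exact: in_veroneseP.
(* Both memberships are vanishing conditions in each degree, degree [m] in the generators being
   degree [m * n] in the plane. *)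
rewrite relIP // inJP; split=> h m.
  by have := h (m * n)%N; rewrite lin_xgen // dvdn_mull // mulnK.
by rewrite lin_xgen // h if_same.
Qed.
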